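(* Let $\theta_1,\theta_2,\theta_3$ be real numbers such that $1,\theta_1,\theta_2,\theta_3$ are linearly independent over $\mathbb{Z}$, and let $\Theta=(\theta_1,\theta_2,\theta_3)^{T}$ (the case $m=1$, $n=3$). Then $$\beta(\Theta)\geqslant \alpha(\Theta)\, g_1(\alpha(\Theta)),$$ where for $\alpha>0$ $$g_1(\alpha)=\frac{\alpha(1-\alpha)+\sqrt{\alpha^2(1-\alpha)^2+4\alpha(2\alpha^2-2\alpha+1)}}{2(2\alpha^2-2\alpha+1)}.$$
   Context: For real $t$, $\|t\|$ denotes the distance from $t$ to the nearest integer. For a real $n\times m$ matrix $\Theta=(\theta_j^i)$ consider the linear forms $L_j(\mathbf{x})=\sum_{i=1}^m\theta_j^i x_i$, $1\le j\le n$, $\mathbf{x}=(x_1,\dots,x_m)$, and $M(\mathbf{x})=\max_{1\le i\le m}|x_i|$. Define $$\psi_\Theta(t)=\min_{\mathbf{x}\in\mathbb{Z}^m:\,0<M(\mathbf{x})\le t}\ \max_{1\le j\le n}\|L_j(\mathbf{x})\|.$$ Assuming $\psi_\Theta(t)>0$ for all $t>0$, the uniform exponent $\alpha(\Theta)$ is the supremum of the set of $\gamma>0$ with $\limsup_{t\to+\infty}t^\gamma\psi_\Theta(t)<+\infty$, and the individual exponent $\beta(\Theta)$ is the supremum of the set of $\gamma>0$ with $\liminf_{t\to+\infty}t^\gamma\psi_\Theta(t)<+\infty$. Here $m=1$, $n=3$, $L_j(x)=\theta_j x$. *)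

(* Defs.v *)
From HB Require Import structures.
From mathcomp Require Import all_boot all_order all_algebra.
From mathcomp Require Import all_classical all_reals all_analysis.

Set Implicit Arguments.
Unset Strict Implicit.
Unset Printing Implicit Defensive.

Import Order.TTheory GRing.Theory Num.Theory.
Import numFieldNormedType.Exports.

Local Open Scope classical_set_scope.
Local Open Scope ring_scope.

Definition dist_int (R : realType) (t : R) : R :=
  inf [set `|t - k%:~R| | k in [set: int]].

Definition linform (R : realType) (n m : nat) (Theta : 'M[R]_(n, m))
    (j : 'I_n) (x : 'cV[int]_m) : R :=
  \sum_(i < m) Theta j i * (x i ord0)%:~R.

Definition height (m : nat) (x : 'cV[int]_m) : nat :=
  (\max_(i < m) `|x i ord0|)%N.

(* The values of the maximum are nonnegative, so 0 is a neutral default. *)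
Definition approx_error (R : realType) (n m : nat) (Theta : 'M[R]_(n, m))
    (x : 'cV[int]_m) : R :=
  \big[Num.max/0]_(j < n) dist_int (linform Theta j x).

(* Only finitely many integer vectors x satisfy 0 < height x <= t, so for      *)
(* m >= 1 and t >= 1 the infimum is a minimum and is finite.  For t < 1 there  *)
(* is no such x and the value is +oo.                                          *)
Definition psi (R : realType) (n m : nat) (Theta : 'M[R]_(n, m)) (t : R)
    : \bar R :=
  ereal_inf [set (approx_error Theta x)%:E
            | x in [set x : 'cV[int]_m | (0 < height x)%N /\
                                         (height x)%:R <= t]].

(* Both exponents are suprema in the extended reals: the individual exponent   *)
(* may be infinite.                                                            *)
Definition uniform_exponent (R : realType) (n m : nat) (Theta : 'M[R]_(n, m))
    : \bar R :=
  ereal_sup [set gamma%:E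
            | gamma in [set gamma : R | 0 < gamma /\
                (limf_esup (fun t : R => (t `^ gamma)%:E * psi Theta t)
                   (pinfty_nbhs R) < +oo)%E]].

Definition individual_exponent (R : realType) (n m : nat)
    (Theta : 'M[R]_(n, m)) : \bar R :=
  ereal_sup [set gamma%:E
            | gamma in [set gamma : R | 0 < gamma /\
                (limf_einf (fun t : R => (t `^ gamma)%:E * psi Theta t)
                   (pinfty_nbhs R) < +oo)%E]].

Definition g1 (R : realType) (a : R) : R :=
  (a * (1 - a) +
     Num.sqrt (a ^+ 2 * (1 - a) ^+ 2 + 4 * a * (2 * a ^+ 2 - 2 * a + 1)))
  / (2 * (2 * a ^+ 2 - 2 * a + 1)).

(* Main.v *)
Require Import Defs.
From mathcomp Require Import all_boot all_order all_algebra.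
From mathcomp Require Import all_classical all_reals all_analysis.
From mathcomp Require Import fingroup perm.
From mathcomp Require Import zify ring lra.

(* Let q_i be the denominators of the best approximations, z_i in Z^4 the     *)
(* corresponding integer vectors and zeta_i their errors.  By linear          *)
(* independence every tail of (z_i) spans Q^4, so there are arbitrarily large *)
(* k and nu > k + 1 such that z_nu lies in the plane of z_{k+1}, z_{k+2} and  *)
(* z_k, z_{k+1}, z_{k+2}, z_{nu+1} are independent.  Put                      *)
(* w = q_{k+1} z_{k+2} - q_{k+2} z_{k+1}; then                                *)
(*   q_nu det(z_{k+1}, z_{k+2}, z_k, z_{nu+1}) = det(z_nu, w, z_k, z_{nu+1}), *)
(* and since w has first coordinate 0 the right-hand side is                  *)
(*   O(zeta_k zeta_{k+1} q_{k+2} zeta_nu q_{nu+1}).                           *)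
(* If zeta_i << q_{i+1}^-a and zeta_i >> q_i^-gamma, this forces G = gamma/a  *)
(* to satisfy (1 - a) G^2 >= a G + a, which fails for every G < g1 alpha at   *)
(* a = alpha, because 1/3 <= alpha <= 1.                                      *)

Set Implicit Arguments.
Unset Strict Implicit.
Unset Printing Implicit Defensive.

Import Order.TTheory GRing.Theory Num.Theory.
Import numFieldNormedType.Exports.

Local Open Scope ring_scope.

(** * Best approximations *)

(** On [[q_i, q_{i+1})] the function [psi] is constant, equal to [zeta_i]. The exponents therefore
    compare [zeta_i] with [q_{i+1}] and with [q_i]; [uniform_best] and [individual_best] turn them
    into linear inequalities between logarithms. The third input is arithmetic. Consecutive vectors
    [z_i] span a plane, but every tail spans the whole space, so planes and three-dimensional spaces
    must be left again and again; [span_pattern] finds the indices [k] and [nu] where this happens.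
    Four independent integer vectors have a determinant of absolute value at least 1, and trading
    the basis of the plane for [z_nu] and [w] multiplies it by [q_nu]. This gain yields [best_det].
    If the individual exponent fell short of the bound, all these inequalities would hold together;
    [exponent_contra] eliminates everything but [ln q_{k+1}], which would then be bounded. [g1_spec]
    ties the quadratic condition of this elimination to [g1], for [alpha] in the range given by
    [uniform_exponent_fin]. *)

Definition nint (R : realType) (t : R) : int := Num.floor (t + 2^-1).

Lemma nint_dist (R : realType) (t : R) : `|t - (nint t)%:~R| <= 2^-1.
Proof.
have /andP[h1 h2] := floor_itv (t + 2^-1).
rewrite -/(nint t) intrD in h1 h2; rewrite ler_norml; apply/andP; split; lra.
Qed.

Lemma nint_min (R : realType) (t : R) (k : int) :
  `|t - (nint t)%:~R| <= `|t - k%:~R|.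
Proof.
have [->//|nk] := eqVneq k (nint t).
have h : 1 <= `|(nint t)%:~R - k%:~R : R|.
  rewrite -intrB -intr_norm -[1]/(1%:~R) ler_int.
  by rewrite -gtz0_ge1 normr_gt0 subr_eq0 eq_sym.
have h1 := nint_dist t.
have h2 : `|(nint t)%:~R - k%:~R : R| <= `|t - (nint t)%:~R| + `|t - k%:~R|.
  have -> : (nint t)%:~R - k%:~R = (t - k%:~R) - (t - (nint t)%:~R) by ring.
  by rewrite [leRHS]addrC; exact: ler_normB.
lra.
Qed.

Lemma dist_intE (R : realType) (t : R) : dist_int t = `|t - (nint t)%:~R|.
Proof.
apply/eqP; rewrite eq_le; apply/andP; split.
  apply: ge_inf; last by exists (nint t).
  by exists 0 => _ [k _ <-].
apply: lb_le_inf; first by exists `|t - 0%:~R|; exists 0.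
by move=> _ [k _ <-]; exact: nint_min.
Qed.

Lemma dist_int_ge0 (R : realType) (t : R) : 0 <= dist_int t.
Proof. by rewrite dist_intE. Qed.

Lemma dist_int_le (R : realType) (t : R) (k : int) : dist_int t <= `|t - k%:~R|.
Proof. by rewrite dist_intE; exact: nint_min. Qed.

Lemma dist_intN (R : realType) (t : R) : dist_int (- t) = dist_int t.
Proof.
have le s : dist_int (- s) <= dist_int s.
  rewrite [leRHS]dist_intE; apply: le_trans (dist_int_le _ (- nint s)) _.
  by rewrite intrN -opprD normrN.
by apply/eqP; rewrite eq_le le -{1}(opprK t) le.
Qed.

Definition err (R : realType) (n : nat) (Theta : 'M[R]_(n, 1)) (q : nat) : R :=
  \big[Num.max/0]_(j < n) dist_int (q%:R * Theta j ord0).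

Lemma approx_error_err (R : realType) (n : nat) (Theta : 'M[R]_(n, 1))
    (x : 'cV[int]_1) : approx_error Theta x = err Theta `|x ord0 ord0|%N.
Proof.
apply: eq_bigr => j _; rewrite /linform big_ord1 mulrC.
have [h|h] := leP 0 (x ord0 ord0).
  by rewrite -{1}(gez0_abs h).
by rewrite -{1}[x _ _]opprK -(ltz0_abs h) intrN mulNr dist_intN.
Qed.

Lemma err_ge0 (R : realType) n (Theta : 'M[R]_(n, 1)) q : 0 <= err Theta q.
Proof. exact: bigmax_ge_id. Qed.

Lemma dist_int_err (R : realType) n (Theta : 'M[R]_(n, 1)) q j :
  dist_int (q%:R * Theta j ord0) <= err Theta q.
Proof. exact: le_bigmax. Qed.

Lemma psi_le (R : realType) n (Theta : 'M[R]_(n, 1)) (q : nat) (t : R) :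
  (0 < q)%N -> q%:R <= t -> (psi Theta t <= (err Theta q)%:E)%E.
Proof.
move=> q0 qt; apply: ereal_inf_lbound; exists (const_mx q%:Z).
  by split; rewrite /height big_ord1 mxE absz_nat.
by rewrite approx_error_err mxE absz_nat.
Qed.

Lemma psi_ge (R : realType) n (Theta : 'M[R]_(n, 1)) (e t : R) :
  (forall q : nat, (0 < q)%N -> q%:R <= t -> e <= err Theta q) ->
  (e%:E <= psi Theta t)%E.
Proof.
move=> h; apply: le_ereal_inf_tmp => _ [x [x0 xt] <-].
by rewrite lee_fin approx_error_err; move: x0 xt; rewrite /height big_ord1; exact: h.
Qed.

(** Pigeonhole: the multiples by [0, ..., N ^ n] are one more than the cubes of side [1 / N], so two
    of them share a cube modulo 1, and their difference gives [q]. *)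
Lemma dirichlet (R : realType) n (Theta : 'M[R]_(n, 1)) (N : nat) :
  (0 < N)%N ->
  exists q : nat, [/\ (0 < q)%N, (q <= N ^ n)%N & err Theta q <= N%:R^-1].
Proof.
case: N => // N _.
pose fr (t : R) := t - (Num.floor t)%:~R.
have fr_itv t : 0 <= fr t < 1.
  have /andP[h1 h2] := floor_itv t; rewrite intrD in h2; rewrite /fr.
  by apply/andP; split; lra.
pose cell (t : R) : 'I_N.+1 := inord `|Num.floor (N.+1%:R * fr t)|%N.
have cellE t : (cell t : nat)%:R <= N.+1%:R * fr t < (cell t : nat)%:R + 1.
  have /andP[f0 f1] := fr_itv t.
  have N0 : (0 : R) < N.+1%:R by [].
  have g0 : 0 <= N.+1%:R * fr t by apply: mulr_ge0.
  have fl0 : 0 <= Num.floor (N.+1%:R * fr t) by rewrite floor_ge0.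
  have gN : N.+1%:R * fr t < N.+1%:R by rewrite -ltr_pdivlMl // mulVf ?lt0r_neq0.
  have /andP[h1 h2] := floor_itv (N.+1%:R * fr t).
  rewrite /cell inordK; last first.
    rewrite -ltz_nat gez0_abs // -(ltr_int R); exact: le_lt_trans gN.
  rewrite -[(absz _)%:R]/((absz (Num.floor (N.+1%:R * fr t)))%:Z%:~R) gez0_abs //.
  by rewrite intrD in h2; rewrite h1.
pose f (x : 'I_(N.+1 ^ n).+1) : {ffun 'I_n -> 'I_N.+1} :=
  [ffun j => cell ((x : nat)%:R * Theta j ord0)].
have /injectivePn[x [y xy fxy]] : ~~ injectiveb f.
  apply/negP => /injectiveP /leq_card.
  by rewrite card_ord card_ffun !card_ord ltnn.
wlog ltxy : x y xy fxy / (x < y)%N.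
  move=> wl; have [|yx|e] := ltngtP x y; first exact: (wl x y).
    by apply: (wl y x) => //; rewrite eq_sym.
  by move: xy; rewrite (val_inj e) eqxx.
exists (y - x)%N; split; first by rewrite subn_gt0.
  by apply: leq_trans (leq_subr _ _) _; rewrite -ltnS.
apply: bigmax_le => [|j _]; first by rewrite invr_ge0.
set s := (x : nat)%:R * Theta j ord0; set t := (y : nat)%:R * Theta j ord0.
have := congr1 (fun g : {ffun 'I_n -> 'I_N.+1} => g j) fxy.
rewrite !ffunE -/s -/t => est.
apply: le_trans (dist_int_le _ (Num.floor t - Num.floor s)) _.
have /andP[a1 a2] := cellE s; have /andP[b1 b2] := cellE t.
rewrite est in a1 a2.
rewrite natrB ?(ltnW ltxy) // intrB.
have -> : ((y : nat)%:R - (x : nat)%:R) * Theta j ord0 -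
  ((Num.floor t)%:~R - (Num.floor s)%:~R) = fr t - fr s by rewrite /fr /s /t; ring.
rewrite -[N.+1%:R^-1]mul1r ler_pdivlMr // -[N.+1%:R in leLHS]ger0_norm // -normrM.
rewrite ler_norml mulrC mulrBr; apply/andP; split; lra.
Qed.

(** By the last two clauses together, [q i.+1] is the first positive integer with an error smaller
    than that of [q i]. *)
Definition best_seq (R : realType) n (Theta : 'M[R]_(n, 1)) (q : nat -> nat) :=
  [/\ (forall i, 0 < q i)%N, (forall i, q i < q i.+1)%N,
      (forall i, err Theta (q i.+1) < err Theta (q i)) &
      forall i x, (0 < x < q i.+1)%N -> err Theta (q i) <= err Theta x].

Lemma best_approximations (R : realType) n (Theta : 'M[R]_(n, 1)) :
  (forall q : nat, (0 < q)%N -> 0 < err Theta q) ->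
  exists q : nat -> nat, best_seq Theta q.
Proof.
move=> err0.
(* Positivity is assumed inside the existential, so that [choice] gives a total function; the value
   at 0 is a dummy. *)
have next q : exists q' : nat, (0 < q)%N ->
    [/\ (q < q')%N, err Theta q' < err Theta q &
        forall x, (q < x < q')%N -> err Theta q <= err Theta x].
  case: q => [|q]; first by exists 0.
  have : exists x, ((q.+1 < x)%N && (err Theta x < err Theta q.+1)).
    (* By Dirichlet some x beats all the errors of 1, ..., q + 1, so x > q + 1. *)
    pose m : R := \big[Num.min/1]_(i < q.+1) err Theta i.+1.
    have m0 : 0 < m by apply: lt_bigmin => // i _; exact: err0.
    have [x [x0 _ xm]] := dirichlet Theta (isT : (0 < (Num.truncn m^-1).+1)%N).
    have xm' : err Theta x < m.
      apply: le_lt_trans xm _; rewrite invf_plt ?posrE //.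
      exact: truncnS_gt.
    have mle i : (i < q.+1)%N -> m <= err Theta i.+1.
      by move=> iq; have := bigmin_le 1 (Ordinal iq) (fun i : 'I_q.+1 => err Theta i.+1).
    exists x; rewrite (lt_le_trans xm') ?mle // andbT ltnNge; apply/negP => xq.
    by case: x x0 xq {xm} xm' => // x _ xq; rewrite ltNge mle.
  move=> /ex_minnP[q' /andP[h1 h2] hm]; exists q' => _; split => // x /andP[x1 x2].
  rewrite leNgt; apply/negP => h; have := hm x; rewrite x1 h => /(_ isT).
  by rewrite leqNgt x2.
have [f fP] := choice next.
pose q i := iter i f 1%N.
have q0 i : (0 < q i)%N.
  by elim: i => //= i IH; have [h _ _] := fP _ IH; exact: ltn_trans h.
exists q; split => // i; try by have [] := fP _ (q0 i).
elim: i => [|i IH] x /andP[x0 xq].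
  have [_ _ h] := fP _ (q0 0%N); have [->//|x1] := eqVneq x 1%N.
  by apply: h; rewrite xq andbT /q /= ltn_neqAle eq_sym x1.
have [_ h2 h3] := fP _ (q0 i.+1).
have [xl|xg|->//] := ltngtP x (q i.+1); last by apply: h3; rewrite xg.
have [_ h _] := fP _ (q0 i).
by apply: le_trans (ltW h) _; apply: IH; rewrite x0.
Qed.

(** * The functions psi and the exponents *)

Lemma limf_esup_pinftyP (R : realType) (f : R -> \bar R) :
  (limf_esup f (pinfty_nbhs R) < +oo)%E <->
  exists M C : R, forall t, M < t -> (f t <= C%:E)%E.
Proof.
split=> [/ereal_inf_lt[_ [V [M [_ MV]] <-] supV]|[M [C h]]].
  have [C hC] : exists C : R, (ereal_sup [set f x | x in V] <= C%:E)%E.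
    move: supV; case: (ereal_sup _) => [r _|//|_]; first by exists r.
    by exists 0; rewrite leNye.
  exists M, C => t Mt; apply: le_trans hC; apply: ereal_sup_ubound.
  by exists t => //; exact: MV.
apply: (@le_lt_trans _ _ C%:E); last exact: ltry.
apply: (@le_trans _ _ (ereal_sup [set f x | x in [set t | M < t]]))%classic.
  apply: ereal_inf_lbound; exists [set t | M < t]%classic => //.
  by exists M; split => //; exact: num_real.
by apply: ub_ereal_sup => _ [t Mt <-]; exact: h.
Qed.

Lemma limf_einf_pinfty_ge (R : realType) (f : R -> \bar R) (C : R) :
  ~ (limf_einf f (pinfty_nbhs R) < +oo)%E ->
  exists M : R, forall t, M < t -> (C%:E <= f t)%E.
Proof.
move=> /negP; rewrite -leNgt leye_eq /limf_einf => /eqP h.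
have : (limf_esup (fun t => - f t) (pinfty_nbhs R) < (- C)%:E)%E.
  by rewrite -[X in (X < _)%E]oppeK h ltNyr.
move=> /ereal_inf_lt[_ [V [M [_ MV]] <-] supV].
exists M => t Mt; rewrite -[f t]oppeK leeNr -EFinN; apply: le_trans (ltW supV).
by apply: ereal_sup_ubound; exists t => //; exact: MV.
Qed.

Section BestSeq.
Variables (R : realType) (n : nat) (Theta : 'M[R]_(n, 1)) (q : nat -> nat).
Hypothesis hq : best_seq Theta q.
Hypothesis err0 : forall q : nat, (0 < q)%N -> 0 < err Theta q.

Lemma best_gt i : (i < q i)%N.
Proof.
have [q0 qS _ _] := hq.
by elim: i => [|i IH]; [exact: q0|exact: leq_ltn_trans IH (qS i)].
Qed.

Lemma best_err_gt0 i : 0 < err Theta (q i).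
Proof. by have [q0 _ _ _] := hq; exact: err0. Qed.

Lemma best_mono i j : (i <= j)%N -> (q i <= q j)%N.
Proof.
have [_ qS _ _] := hq.
by apply: (@homo_leq _ q leq leqnn (fun _ _ _ => @leq_trans _ _ _)) => k; exact: ltnW.
Qed.

Lemma best_err_mono i j : (i <= j)%N -> err Theta (q j) <= err Theta (q i).
Proof.
have [_ _ eS _] := hq.
apply: (@homo_leq _ (fun i => err Theta (q i)) (fun x y : R => y <= x)) => [//|y x z xy yz|k].
  exact: le_trans yz xy.
exact: ltW.
Qed.

Lemma psi_best i (t : R) : t < (q i.+1)%:R -> ((err Theta (q i))%:E <= psi Theta t)%E.
Proof.
have [_ _ _ qm] := hq => tq; apply: psi_ge => x x0 xt; apply: qm.
by rewrite x0 -(ltr_nat R) (le_lt_trans xt).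
Qed.

Lemma best_pinfty (B : R) : exists N, forall i, (N <= i)%N -> B < (q i)%:R.
Proof.
exists (Num.truncn B) => i Ni.
apply: lt_le_trans (truncnS_gt B) _; rewrite ler_nat.
by apply: leq_ltn_trans Ni _; exact: best_gt.
Qed.

Lemma ln_best_pinfty (B : R) : exists N, forall i, (N <= i)%N -> B < ln (q i)%:R.
Proof.
have [N hN] := best_pinfty (expR B); exists N => i /hN h.
by rewrite -ltr_expR lnK // posrE (lt_trans _ h) ?expR_gt0.
Qed.

(** The hypothesis is strongest just before [psi] drops, so it is tested at [t = q i.+1 - 1], where
    [psi] is still at least the error of [q i]. *)
Lemma uniform_best (gamma : R) : 0 < gamma ->
  (limf_esup (fun t : R => (t `^ gamma)%:E * psi Theta t)
     (pinfty_nbhs R) < +oo)%E ->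
  exists C N, forall i, (N <= i)%N ->
    gamma * ln (q i.+1)%:R + ln (err Theta (q i)) <= C.
Proof.
move=> g0 /limf_esup_pinftyP[M [C h]].
have [N hN] := best_pinfty (Num.max (M + 1) 2).
exists (ln C + gamma * ln 2), N => i Ni.
have : Num.max (M + 1) 2 < (q i.+1)%:R by apply: hN; exact: leqW.
rewrite gt_max => /andP[qM q2].
have e0 := best_err_gt0 i.
set Q : R := (q i.+1)%:R in qM q2 *.
have p0 : 0 < (Q - 1) `^ gamma by rewrite powR_gt0; lra.
have hC : (Q - 1) `^ gamma * err Theta (q i) <= C.
  rewrite -lee_fin EFinM.
  apply: le_trans (h (Q - 1) _); last by lra.
  by rewrite lee_pmul2l ?fin_numE ?lte_fin // psi_best // -/Q; lra.
have hl : gamma * ln (Q - 1) + ln (err Theta (q i)) <= ln C.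
  rewrite -ln_powR -lnM ?posrE // ler_ln ?posrE ?mulr_gt0 //.
  by apply: lt_le_trans hC; rewrite mulr_gt0.
(* The shift by 1 costs only [ln 2], because [Q > 2]; the other bound in the choice of [N] puts
   [Q - 1] beyond [M]. *)
have hq2 : ln Q <= ln (Q - 1) + ln 2.
  by rewrite -lnM ?posrE ?ler_ln ?posrE; lra.
have := ler_wpM2l (ltW g0) hq2; lra.
Qed.

Lemma individual_best (gamma : R) :
  ~ (limf_einf (fun t : R => (t `^ gamma)%:E * psi Theta t)
     (pinfty_nbhs R) < +oo)%E ->
  exists N, forall i, (N <= i)%N ->
    0 <= gamma * ln (q i)%:R + ln (err Theta (q i)).
Proof.
move=> /(@limf_einf_pinfty_ge _ _ 1)[M h].
have [N hN] := best_pinfty M; exists N => i Ni.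
have e0 := best_err_gt0 i; have [q0 _ _ _] := hq.
have p0 : 0 < (q i)%:R `^ gamma :> R by rewrite powR_gt0 // ltr0n.
rewrite -ln_powR -lnM ?posrE //; apply: ln_ge0.
rewrite -lee_fin EFinM; apply: le_trans (h _ (hN i Ni)) _.
by rewrite lee_pmul2l ?fin_numE ?lte_fin // psi_le.
Qed.

End BestSeq.

(** Dirichlet with [N] the integer part of [u = t ^ (1 / (n + 1))]: then [N ^ n.+1 <= t], and
    [u < N + 1 <= 2 N] gives the constant 2. *)
Lemma uniform_exponent_ge (R : realType) n (Theta : 'M[R]_(n.+1, 1)) :
  ((n.+1%:R^-1)%:E <= uniform_exponent Theta)%E.
Proof.
apply: ereal_sup_ubound; exists n.+1%:R^-1 => //; split; first by rewrite invr_gt0.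
apply/limf_esup_pinftyP; exists 1, 2 => t t1.
set u := t `^ _.
have u1 : 1 <= u by rewrite -(powRr0 t) ler_powR ?invr_ge0 // ltW.
have /andP[N1 N2] := truncn_itv (le_trans ler01 u1).
set N := Num.truncn u in N1 N2.
have N0 : (0 < N)%N by rewrite truncn_gt0.
have [q [q0 qN eq]] := dirichlet Theta N0.
have qt : q%:R <= t.
  apply: (@le_trans _ _ (N ^ n.+1)%:R); first by rewrite ler_nat.
  rewrite natrX; apply: le_trans (_ : u ^+ n.+1 <= _).
    by rewrite lerXn2r // nnegrE // (le_trans _ u1).
  by rewrite -powR_mulrn ?powR_ge0 // -powRrM mulVf ?pnatr_eq0 // powRr1 //; lra.
have u0 : 0 < u by lra.
apply: (@le_trans _ _ (u%:E * (err Theta q)%:E)%E).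
  by rewrite lee_pmul2l ?fin_numE ?lte_fin // psi_le.
rewrite -EFinM lee_fin.
have N1R : 1 <= N%:R :> R by rewrite ler1n.
apply: (@le_trans _ _ (u * N%:R^-1)); first by rewrite ler_pM2l.
rewrite ler_pdivrMr; last by lra.
by rewrite -natr1 in N2; lra.
Qed.

(** * The determinant inequality *)

(* nu + 1 is the first index at which the tail from K spans everything, and    *)
(* k + 1 the first one from which all vectors up to nu lie in the last plane. *)
Lemma span_pattern (F : fieldType) (Z : nat -> 'rV[F]_4) :
  (forall i, \rank (Z i + Z i.+1)%MS = 2%N) ->
  (forall K (c : 'cV_4), (forall i, (K <= i)%N -> Z i *m c = 0) -> c = 0) ->
  forall K, exists k nu, [/\ (K <= k)%N, (k.+1 < nu)%N,
    (Z nu <= Z k.+1 + Z k.+2)%MS &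
    \rank (Z k + (Z k.+1 + Z k.+2) + Z nu.+1)%MS = 4%N].
Proof.
move=> rk2 tail K.
pose W m := (\sum_(K <= i < m) <<Z i>>)%MS.
have WS m : (K <= m)%N -> W m.+1 = (W m + <<Z m>>)%MS.
  by move=> Km; rewrite /W big_nat_recr.
have Wle m m' : (m <= m')%N -> (W m <= W m')%MS.
  apply: (homo_leq (r := fun m m' => (m <= m')%MS)) => [//|? ? ?|i].
    exact: submx_trans.
  have [Ki|iK] := leqP K i; first by rewrite WS // addsmxSl.
  by rewrite /W big_geq ?sub0mx // ltnW.
have ZW i m : (K <= i < m)%N -> (Z i <= W m)%MS.
  move=> /andP[Ki im]; apply: submx_trans (Wle _ _ im).
  by rewrite WS // -[(Z i <= _)%MS](genmxE (Z i)) addsmxSr.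
(* Where the rank of [W] is maximal, [W m] contains the whole tail, so each column of its cokernel
   kills the tail and vanishes by hypothesis. *)
have full : exists m, \rank (W m) == 4%N.
  have exr : exists r, `[< exists m, \rank (W m) = r >].
    by exists (\rank (W 0)); apply/asboolP; exists 0%N.
  have bndr r : `[< exists m, \rank (W m) = r >] -> (r <= 4)%N.
    by move=> /asboolP[m <-]; exact: rank_leq_col.
  have [r /asboolP[m Wr] rmax] := ex_maxnP exr bndr.
  exists m; rewrite eqn_leq rank_leq_col /=.
  have ZWm i : (K <= i)%N -> (Z i <= W m)%MS.
    move=> Ki; have : (Z i <= W (maxn m i.+1))%MS.
      by apply: ZW; rewrite Ki leq_max ltnSn orbT.
    move=> /submx_trans; apply.
    rewrite -(geq_leqif (mxrank_leqif_sup (Wle _ _ (leq_maxl m i.+1)))) Wr.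
    by apply: rmax; apply/asboolP; exists (maxn m i.+1).
  have co0 : cokermx (W m) = 0.
    apply/matrixP => i j; rewrite [RHS]mxE.
    have c0 : col j (cokermx (W m)) = 0.
      apply: (tail K) => l Kl; have [D ->] := submxP (ZWm _ Kl).
      by rewrite colE -mulmxA (mulmxA (W m)) mulmx_coker mul0mx mulmx0.
    by have := congr1 (fun c : 'cV_4 => c i ord0) c0; rewrite !mxE.
  by have := mxrank_coker (W m); rewrite co0 mxrank0 => /esym/eqP; rewrite subn_eq0.
case: (ex_minnP full) => -[|m] /eqP Wm mmin.
  by move: Wm; rewrite /W big_geq // mxrank0.
have Km : (K <= m)%N.
  by rewrite leqNgt; apply/negP => h; move: Wm; rewrite /W big_geq ?mxrank0.
have Wm3 : \rank (W m) = 3%N.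
  apply/eqP; rewrite eqn_leq; apply/andP; split.
    rewrite -ltnS ltn_neqAle rank_leq_col andbT; apply/negP => h.
    by have := mmin _ h; rewrite ltnn.
  have := (mxrank_adds_leqif (W m) <<Z m>>%MS).1; rewrite -WS // Wm genmxE.
  have := rank_leq_row (Z m); lia.
have Km2 : (K.+2 <= m)%N.
  rewrite leqNgt; apply/negP => h; have : (W m <= Z K)%MS.
    have [->|mK] := eqVneq m K; first by rewrite /W big_geq ?sub0mx.
    have -> : m = K.+1 by lia.
    by rewrite /W big_nat1 genmxE.
  by move=> /mxrankS; rewrite Wm3; have := rank_leq_row (Z K); lia.
(* After this shift [W m.+2] has rank 3 and [Z m.+2] completes it to rank 4, so [nu] will be
   [m.+1]. *)
case: m Km Km2 Wm mmin Wm3 => [//|[|m]] // Km Km2 Wm mmin Wm3.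
set P := (Z m + Z m.+1)%MS.
pose S k := (K <= k <= m)%N && [forall i : 'I_m.+2, (k <= i)%N ==> (Z i <= P)%MS].
have SP k : S k -> forall i, (k <= i <= m.+1)%N -> (Z i <= P)%MS.
  move=> /andP[_ /forallP h] i /andP[ki im].
  by have := h (Ordinal (im : i < m.+2)%N); rewrite ki.
have exS : exists k, S k.
  exists m; apply/andP; split; first by rewrite leqnn andbT; lia.
  apply/forallP => -[i /= im]; apply/implyP => mi.
  have [->|->] : i = m \/ i = m.+1 by lia.
    exact: addsmxSl.
  exact: addsmxSr.
case: (ex_minnP exS) => k Sk kmin; have /andP[/andP[Kk km] _] := Sk.
have P2 : \rank P = 2%N by exact: rk2.
have Kk1 : (K < k)%N.
  rewrite ltn_neqAle Kk andbT; apply/negP => /eqP Ke; subst k.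
  have : (W m.+2 <= P)%MS.
    rewrite /W big_nat; apply: (big_ind (fun X : 'M[F]_4 => (X <= P)%MS)).
    - exact: sub0mx.
    - by move=> X Y XP YP; rewrite addsmx_sub XP.
    move=> i /andP[Ki im].
    rewrite genmxE; apply: (SP K) => //; by rewrite Ki.
  by move/mxrankS; rewrite Wm3 P2.
case: k Sk kmin Kk km Kk1 => [//|k] Sk kmin Kk km Kk1.
(* Minimality of [k.+1]: otherwise the run of vectors inside [P] would already start at [k]. *)
have nZk : ~~ (Z k <= P)%MS.
  apply/negP => Zk; suff /kmin : S k by rewrite ltnn.
  apply/andP; split; first by lia.
  apply/forallP => -[i /= im]; apply/implyP => ki.
  by have [->//|ik] := eqVneq i k; apply: (SP _ Sk); lia.
have PP : (P <= Z k.+1 + Z k.+2)%MS.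
  rewrite -(geq_leqif (mxrank_leqif_sup _)) ?P2 ?rk2 //.
  by rewrite addsmx_sub !(SP _ Sk) //; lia.
exists k, m.+1; split; [lia|lia|exact: submx_trans (addsmxSr _ _) PP|].
set H := (Z k + _)%MS.
have HW : (H <= W m.+2)%MS.
  by rewrite !addsmx_sub; apply/and3P; split; apply: ZW; lia.
have PH : (P < H)%MS.
  rewrite ltmxE (submx_trans PP (addsmxSr _ _)) /=; apply: contra nZk.
  by move/(submx_trans (addsmxSl _ _)).
have WH : (W m.+2 <= H)%MS.
  by have := rank_ltmx PH; rewrite -(geq_leqif (mxrank_leqif_sup HW)) Wm3 P2.
apply/eqP; rewrite eqn_leq rank_leq_col /=.
apply: leq_trans (_ : \rank (W m.+3) <= _)%N; first by rewrite Wm.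
by rewrite WS //; apply: mxrankS; apply: addsmxS; rewrite ?genmxE.
Qed.

(** In the Leibniz expansion each term has exactly one factor from column 0, bounded by [Q]; its
    other factors are bounded by [E]. *)
Lemma det_bound (R : realType) n (A : 'M[R]_n.+1) (Q E : 'I_n.+1 -> R) (M : R) :
  (forall i, `|A i ord0| <= Q i) ->
  (forall i j, j != ord0 -> `|A i j| <= E i) ->
  (forall i, Q i * \prod_(l | l != i) E l <= M) ->
  `|\det A| <= (n.+1`!)%:R * M.
Proof.
move=> hQ hE hM; rewrite /determinant.
apply: le_trans (ler_norm_sum _ _ _) _.
apply: (@le_trans _ _ (\sum_(s : 'S_n.+1) M)); last first.
  by rewrite sumr_const card_Sn mulr_natl.
apply: ler_sum => s _; rewrite normrM normrX normrN1 expr1n mul1r normr_prod.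
rewrite (bigD1 ((s^-1)%g ord0)) //= permKV.
apply: le_trans (hM ((s^-1)%g ord0)); apply: ler_pM => //.
  by apply: prodr_ge0.
apply: ler_prod => i ne; rewrite normr_ge0 hE //.
by apply: contra ne => /eqP <-; rewrite permK.
Qed.

Lemma det_col_mull (F : comPzRingType) p m (P : 'M[F]_p) (X : 'M[F]_(p, p + m))
    (Y : 'M[F]_(m, p + m)) :
  \det (col_mx (P *m X) Y) = \det P * \det (col_mx X Y).
Proof.
have -> : col_mx (P *m X) Y = block_mx P 0 0 1%:M *m col_mx X Y.
  by rewrite mul_block_col !mul0mx mul1mx addr0 add0r.
by rewrite det_mulmx det_ublock det1 mulr1.
Qed.

Lemma intr_mx_inj (F : numDomainType) m p :
  injective (map_mx intr : 'M[int]_(m, p) -> 'M[F]_(m, p)).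
Proof.
move=> A B /matrixP AB; apply/matrixP => i j.
by have := AB i j; rewrite !mxE => /intr_inj.
Qed.

Lemma det_block_scalar (F : comPzRingType) (a b c d : F) :
  \det (block_mx a%:M b%:M c%:M d%:M : 'M[F]_(1 + 1)) = a * d - b * c.
Proof.
rewrite (expand_det_row _ ord0) !big_ord_recl big_ord0 addr0 /cofactor !det_mx11.
rewrite !mxE.
have [-> ->] : ord0 = lshift 1 ord0 :> 'I_(1 + 1) /\ lift ord0 ord0 = rshift 1 ord0 :> 'I_(1 + 1).
  by split; apply: val_inj.
have -> : lift (rshift 1 ord0) ord0 = lshift 1 ord0 :> 'I_(1 + 1) by apply: val_inj.
rewrite (unsplitK (inl _)) (unsplitK (inr _)) !row_mxEl !row_mxEr !mxE /=.
by rewrite expr0 expr1 mul1r mulN1r mulrN.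
Qed.

(** * Integer vectors of the best approximations *)

Section IntegerRows.
Variables (R : realType) (n : nat) (Theta : 'M[R]_(n, 1)).

Definition approx_row (x : nat) : 'rV[int]_(1 + n) :=
  row_mx (x%:Z)%:M (\row_j nint (x%:R * Theta j ord0)).

Definition err_row (x : nat) : 'rV[R]_n :=
  \row_j (x%:R * Theta j ord0 - (nint (x%:R * Theta j ord0))%:~R).

(* Multiplication by this matrix turns (q, p) into (q, q theta - p). *)
Definition shear : 'M[R]_(1 + n) := block_mx 1%:M Theta^T 0 (- 1%:M).

Lemma err_row_le x i j : `|err_row x i j| <= err Theta x.
Proof. by rewrite mxE -dist_intE dist_int_err. Qed.

Lemma approx_row_shear x :
  map_mx intr (approx_row x) *m shear = row_mx (x%:R)%:M (err_row x).
Proof.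
rewrite map_row_mx /shear mul_row_block map_scalar_mx !mulmx0 addr0 mulmx1.
rewrite mulmxN mulmx1 mul_scalar_mx; congr row_mx.
by apply/matrixP => i j; rewrite !mxE (ord1 i).
Qed.

Lemma det_shear : `|\det shear| = 1.
Proof. by rewrite det_ublock det1 mul1r -scaleN1r detZ det1 mulr1 normrX normrN1 expr1n. Qed.

Hypothesis indep : forall c : 'cV[int]_(1 + n),
  row_mx 1%:M Theta^T *m map_mx intr c = 0 -> c = 0.

Variable q : nat -> nat.
Hypothesis hq : best_seq Theta q.

(** If all these minors vanished, the errors of [q i.+1] would be those of [q i] scaled by
    [q i.+1 / q i > 1], although they must decrease. *)
Lemma best_minor i : exists j,
  (q i)%:Z * nint ((q i.+1)%:R * Theta j ord0) !=
  (q i.+1)%:Z * nint ((q i)%:R * Theta j ord0).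
Proof.
have [q0 qS eS _] := hq.
apply: contrapT => /forallNP h; have := eS i; rewrite ltNge => /negP; apply.
apply: bigmax_le => [|j _]; first exact: err_ge0.
apply: le_trans (dist_int_err Theta (q i.+1) j).
have /negP := h j; rewrite negbK => /eqP /(congr1 (intr : int -> R)).
rewrite !intrM !dist_intE -![(Posz _)%:~R]/(_%:R).
set p : R := (nint _)%:~R; set p' : R := (nint _)%:~R => e.
have qi0 : (0 : R) < (q i)%:R by rewrite ltr0n.
have qq : (q i)%:R <= (q i.+1)%:R :> R by rewrite ler_nat ltnW.
rewrite -(ler_pM2l qi0) -[X in _ <= X * _](ger0_norm (ltW qi0)) -normrM.
have -> : (q i)%:R * ((q i.+1)%:R * Theta j ord0 - p) =
   (q i.+1)%:R * ((q i)%:R * Theta j ord0 - p') by rewrite mulrBr e; ring.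
by rewrite normrM ger0_norm // ler_wpM2r.
Qed.

(** A nonzero integer minor is at least 1 in absolute value; written through the errors it has two
    terms, each at most [q i.+1 * err Theta (q i)]. *)
Lemma best_prod_ge i : 1 <= 2 * (q i.+1)%:R * err Theta (q i).
Proof.
have [q0 qS eS _] := hq; have [j] := best_minor i.
set p' := nint _; set p := nint _ => ne.
have h : 1 <= `|((q i)%:Z * p' - (q i.+1)%:Z * p)%:~R : R|.
  rewrite -intr_norm -[1]/(1%:~R) ler_int.
  by rewrite -gtz0_ge1 normr_gt0 subr_eq0.
apply: le_trans h _; rewrite intrB !intrM -![(Posz _)%:~R]/(_%:R).
have -> : (q i)%:R * p'%:~R - (q i.+1)%:R * p%:~R =
  (q i.+1)%:R * ((q i)%:R * Theta j ord0 - p%:~R) -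
  (q i)%:R * ((q i.+1)%:R * Theta j ord0 - p'%:~R) :> R by ring.
apply: le_trans (ler_normB _ _) _.
rewrite !normrM -!dist_intE !ger0_norm ?ler0n //.
rewrite -mulrA [leRHS]mulrDl mul1r.
apply: lerD; first by rewrite ler_wpM2l // dist_int_err.
apply: ler_pM; rewrite ?dist_int_ge0 ?ler_nat // ?(ltnW (qS i)) //.
by apply: le_trans (dist_int_err _ _ _) (ltW (eS i)).
Qed.

Lemma best_rank2 i :
  \rank (map_mx intr (approx_row (q i)) + map_mx intr (approx_row (q i.+1)) :
         'M[rat]_(1 + n))%MS = 2%N.
Proof.
have [q0 _ _ _] := hq.
set Z := fun x => map_mx intr (approx_row x) : 'rV[rat]_(1 + n).
rewrite -/(Z (q i)) -/(Z (q i.+1)).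
have Z0 x : Z x ord0 (lshift n ord0) = x%:R.
  by rewrite mxE row_mxEl mxE.
have Zj x j : Z x ord0 (rshift 1 j) = (nint (x%:R * Theta j ord0))%:~R.
  by rewrite mxE row_mxEr mxE.
have nz : Z (q i) != 0.
  apply/eqP => /(congr1 (fun M : 'rV[rat]__ => M ord0 (lshift n ord0))).
  by rewrite Z0 mxE => /eqP; rewrite pnatr_eq0 -leqn0 leqNgt q0.
have lt : (Z (q i) < Z (q i) + Z (q i.+1))%MS.
  rewrite ltmxE addsmxSl /=; apply/negP => /(submx_trans (addsmxSr _ _)).
  move=> /sub_rVP[a e]; have [j /negP] := best_minor i; apply.
  have ae k : Z (q i.+1) ord0 k = a * Z (q i) ord0 k by rewrite e [LHS]mxE.
  have := ae (rshift 1 j); have := ae (lshift n ord0); rewrite !Z0 !Zj => e0 ej.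
  rewrite -(inj_eq (@intr_inj rat)) !intrM -![(Posz _)%:~R]/(_%:R) ej e0.
  by rewrite mulrCA mulrA.
have := rank_ltmx lt; rewrite rank_rV nz => r1.
have := (mxrank_adds_leqif (Z (q i)) (Z (q i.+1))).1.
rewrite !rank_rV nz; case: (_ != 0); lia.
Qed.

Lemma clear_denominators m (c : 'cV[rat]_m) :
  exists (d : rat) (c' : 'cV[int]_m), d != 0 /\ map_mx intr c' = d *: c.
Proof.
exists (\prod_i (denq (c i ord0))%:~R).
exists (\col_i (numq (c i ord0) * \prod_(j | j != i) denq (c j ord0))); split.
  by apply/prodf_neq0 => i _; rewrite intr_eq0 denq_neq0.
apply/matrixP => i j; rewrite !mxE (ord1 j) intrM [in RHS](bigD1 i) //=.
rewrite rmorph_prod.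
by rewrite mulrAC; congr (_ * _); rewrite mulrC numqE.
Qed.

(** Make [c] integral and let [S] be its value on [(1, theta)]. If [c] kills the vector of [q i],
    then [q i * S] involves only the errors and stays bounded while [q i] grows; so [S = 0] and
    independence applies. *)
Lemma best_tail_span K (c : 'cV[rat]_(1 + n)) :
  (forall i, (K <= i)%N -> map_mx intr (approx_row (q i)) *m c = 0) -> c = 0.
Proof.
have [d [c' [d0 dc]]] := clear_denominators c => h.
suff c'0 : c' = 0.
  by move: dc; rewrite c'0 map_mx0 => /esym/eqP; rewrite scaler_eq0 (negPf d0) => /eqP.
apply: indep; set cR : 'cV[R]_(1 + n) := map_mx intr c'.
set S := _ *m cR; apply/matrixP => i0 j0; rewrite !ord1 [RHS]mxE.
pose C := \sum_j `|cR (rshift 1 j) ord0| * err Theta (q 0%N).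
have qS i : (K <= i)%N -> (q i)%:R * `|S ord0 ord0| <= C.
  move=> Ki.
  have e : map_mx intr (approx_row (q i)) *m cR = 0.
    rewrite -map_mxM (_ : _ *m _ = 0) ?map_mx0 //.
    apply: (@intr_mx_inj rat).
    by rewrite map_mxM dc -scalemxAr h // scaler0 map_mx0.
  have qSE : (q i)%:R *: S = err_row (q i) *m dsubmx cR.
    have -> : err_row (q i) = (q i)%:R *: Theta^T -
        map_mx intr (\row_j nint ((q i)%:R * Theta j ord0)).
      by apply/matrixP => a b; rewrite !mxE (ord1 a).
    move: e; rewrite /S -[cR](vsubmxK cR) !map_row_mx !mul_row_col col_mxKd.
    rewrite map_scalar_mx mul_scalar_mx mul1mx mulmxBl => /eqP.
    by rewrite addrC addr_eq0 => /eqP ->; rewrite opprK scalerDr addrC scalemxAl.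
  have -> : (q i)%:R * `|S ord0 ord0| = `|(err_row (q i) *m dsubmx cR) ord0 ord0|.
    by rewrite -qSE [X in _ = `|X|]mxE normrM ger0_norm.
  rewrite mxE; apply: le_trans (ler_norm_sum _ _ _) _.
  apply: ler_sum => j _; rewrite normrM mulrC [dsubmx _ _ _]mxE.
  rewrite ler_wpM2l // (le_trans (err_row_le _ _ _)) //.
  exact: best_err_mono.
apply/eqP; rewrite -normr_eq0 eq_le normr_ge0 andbT leNgt; apply/negP => S0.
have [N hN] := best_pinfty hq (C / `|S ord0 ord0|).
have := hN (maxn K N) (leq_maxr _ _); rewrite ltr_pdivrMr // ltNge => /negP; apply.
exact: qS (leq_maxl _ _).
Qed.
End IntegerRows.

Lemma best_det_identity (R : realType) (Theta : 'M[R]_(3, 1)) (q : nat -> nat) :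
  best_seq Theta q ->
  (forall c : 'cV[int]_(1 + 3),
     row_mx 1%:M Theta^T *m map_mx intr c = 0 -> c = 0) ->
  forall K, exists k nu, [/\ (K <= k)%N, (k.+1 < nu)%N &
    let z i := approx_row Theta (q i) in
    ((q nu)%:Z <= `|\det (col_mx
       (col_mx (z nu) ((q k.+1)%:Z *: z k.+2 - (q k.+2)%:Z *: z k.+1))
       (col_mx (z k) (z nu.+1)) : 'M[int]_4)|)].
Proof.
move=> hq indep K.
pose z i := approx_row Theta (q i).
pose Z i : 'rV[rat]_(1 + 3) := map_mx intr (z i).
have [k [nu [Kk knu Znu rk4]]] := @span_pattern _ Z (best_rank2 hq) (best_tail_span indep hq) K.
exists k, nu; split=> //=; rewrite -/(z nu) -/(z nu.+1) -/(z k) -/(z k.+1) -/(z k.+2).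
set w := _ - _.
have /sub_addsmxP[[s t] /=] := Znu.
rewrite [s]mx11_scalar [t]mx11_scalar; set a := s _ _; set b := t _ _ => Znu'.
pose B0 : 'M[int]_4 := col_mx (col_mx (z k.+1) (z k.+2)) (col_mx (z k) (z nu.+1)).
set B := (X in \det X).
(* [P] expresses [z_nu] and [w] in the basis [z_{k+1}], [z_{k+2}]; its determinant is the first
   coordinate of [z_nu]. *)
pose P : 'M[rat]_(1 + 1) :=
  block_mx a%:M b%:M (- (q k.+2)%:R)%:M ((q k.+1)%:R)%:M.
have Z0 i : Z i ord0 (lshift 3 (ord0 : 'I_1)) = (q i)%:R.
  by rewrite mxE row_mxEl mxE.
have detP : \det P = (q nu)%:R.
  rewrite det_block_scalar -!Z0 Znu' !mul_scalar_mx.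
  by rewrite mulrN opprK [RHS]mxE; congr (_ + _); rewrite [RHS]mxE.
have mB0 : map_mx intr B0 =
    col_mx (col_mx (Z k.+1) (Z k.+2)) (col_mx (Z k) (Z nu.+1)).
  have := @map_col_mx _ _ (intr : int -> rat) (1 + 1) (1 + 1) (1 + 3)
    (col_mx (z k.+1) (z k.+2)) (col_mx (z k) (z nu.+1)).
  rewrite (@map_col_mx _ _ _ 1 1 (1 + 3) (z k.+1)).
  by rewrite (@map_col_mx _ _ _ 1 1 (1 + 3) (z k)).
have detB : \det B = (q nu)%:Z * \det B0.
  apply: (@intr_inj rat); rewrite intrM -!det_map_mx -[(Posz _)%:~R]/(_%:R) -detP.
  have eP : P *m col_mx (Z k.+1) (Z k.+2) = col_mx (Z nu) (map_mx intr w).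
    rewrite mul_block_col -Znu' !mul_scalar_mx; congr col_mx.
    by apply/matrixP => i j; rewrite !mxE intrD intrN !intrM addrC mulNr.
  have := @det_col_mull _ (1 + 1) (1 + 1) P (col_mx (Z k.+1) (Z k.+2)) (col_mx (Z k) (Z nu.+1)).
  rewrite eP mB0 => <-; congr (\det _).
  by rewrite !map_col_mx.
have detB0 : \det B0 != 0.
  rewrite -(intr_eq0 rat) -det_map_mx -unitfE -[_ \is a _]/(_ \in unitmx).
  rewrite -row_full_unit /row_full eqn_leq rank_leq_col /=.
  rewrite -{1}rk4; apply: mxrankS.
  pose C : 'M[rat]_(1 + 1 + (1 + 1), 1 + 3) :=
    col_mx (col_mx (Z k.+1) (Z k.+2)) (col_mx (Z k) (Z nu.+1)).
  have : (C <= C)%MS by [].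
  rewrite {1}/C !col_mx_sub => /andP[/andP[h1 h2] /andP[h3 h4]].
  by rewrite mB0 !addsmx_sub h1 h2 h3 h4.
rewrite detB normrM ger0_norm // ler_peMr //.
by rewrite -gtz0_ge1 normr_gt0.
Qed.

Lemma det4_bound (R : realType) (r0 r1 r2 r3 : 'rV[R]_(1 + 3))
    (Q0 Q1 Q2 Q3 E0 E1 E2 E3 M : R) :
  let bounded (r : 'rV[R]_(1 + 3)) Q E :=
    `|r ord0 ord0| <= Q /\ forall j, j != ord0 -> `|r ord0 j| <= E in
  bounded r0 Q0 E0 -> bounded r1 Q1 E1 -> bounded r2 Q2 E2 -> bounded r3 Q3 E3 ->
  Q0 * (E1 * (E2 * E3)) <= M -> Q1 * (E0 * (E2 * E3)) <= M ->
  Q2 * (E0 * (E1 * E3)) <= M -> Q3 * (E0 * (E1 * E2)) <= M ->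
  `|\det (col_mx (col_mx r0 r1) (col_mx r2 r3) : 'M[R]_4)| <= 24 * M.
Proof.
move=> bounded [b0 c0] [b1 c1] [b2 c2] [b3 c3] h0 h1 h2 h3.
pose A : 'M[R]_(1 + 1 + (1 + 1), 1 + 3) := col_mx (col_mx r0 r1) (col_mx r2 r3).
have rowE (i : 'I_(1 + 1 + (1 + 1))) j : A i j = nth 0 [:: r0; r1; r2; r3] i ord0 j.
  case: (split_ordP i) => i1 ->; rewrite /A ?col_mxEu ?col_mxEd;
  by case: (split_ordP i1) => i2 ->; rewrite ?col_mxEu ?col_mxEd (ord1 i2).
have -> : 24 = (4`!)%:R :> R by [].
apply: (@det_bound _ 3 A (fun i => nth 0 [:: Q0; Q1; Q2; Q3] i)
  (fun i => nth 0 [:: E0; E1; E2; E3] i)).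
- by case=> [[|[|[|[|//]]]] p]; rewrite rowE.
- by case=> [[|[|[|[|//]]]] p] j j0; rewrite rowE /=; auto.
by case=> [[|[|[|[|//]]]] p]; rewrite big_mkcond !big_ord_recl big_ord0 /= ?mul1r ?mulr1.
Qed.

(** The constant is [48 = 4! * 2]: the number of permutations, times the two terms in the error of
    [w]. *)
Lemma best_det (R : realType) (Theta : 'M[R]_(3, 1)) (q : nat -> nat) :
  best_seq Theta q ->
  (forall c : 'cV[int]_(1 + 3),
     row_mx 1%:M Theta^T *m map_mx intr c = 0 -> c = 0) ->
  forall K, exists k nu, [/\ (K <= k)%N, (k.+1 < nu)%N &
    (q nu)%:R <= 48 * (err Theta (q k) * err Theta (q k.+1) * (q k.+2)%:R *
                       (err Theta (q nu) * (q nu.+1)%:R))].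
Proof.
move=> hq indep K; pose zeta i := err Theta (q i).
have [k [nu [Kk knu /=]]] := best_det_identity hq indep K.
exists k, nu; split=> //.
set w := _ - _ in p; set B := (X in \det X) in p.
pose r i : 'rV[R]_(1 + 3) := row_mx (q i)%:R%:M (err_row Theta (q i)).
pose rw : 'rV[R]_(1 + 3) := (q k.+1)%:R *: r k.+2 - (q k.+2)%:R *: r k.+1.
have detB : `|(\det B)%:~R| =
    `|\det (col_mx (col_mx (r nu) rw) (col_mx (r k) (r nu.+1)) : 'M[R]_4)|.
  have -> : col_mx (col_mx (r nu) rw) (col_mx (r k) (r nu.+1)) =
      map_mx intr B *m shear Theta.
    rewrite !map_col_mx !mul_col_mx !approx_row_shear.
    congr (col_mx (col_mx _ _) _).
    have -> : map_mx intr w = (q k.+1)%:R *: map_mx intr (approx_row Theta (q k.+2)) -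
        (q k.+2)%:R *: map_mx intr (approx_row Theta (q k.+1)) :> 'rV[R]_(1 + 3).
      by apply/matrixP => i j; rewrite !mxE intrD intrN !intrM.
    by rewrite mulmxBl -!scalemxAl !approx_row_shear.
  by rewrite -det_map_mx det_mulmx normrM det_shear mulr1.
have r0 i : r i ord0 ord0 = (q i)%:R.
  have -> : ord0 = lshift 3 (ord0 : 'I_1) :> 'I_(1 + 3) by apply: val_inj.
  by rewrite row_mxEl mxE.
have rj i (j : 'I_(1 + 3)) : j != ord0 -> `|r i ord0 j| <= zeta i.
  case: (split_ordP j) => j1 ->; first by rewrite (ord1 j1) => /eqP[]; apply: val_inj.
  by move=> _; rewrite row_mxEr err_row_le.
have rwE j : rw ord0 j =
    (q k.+1)%:R * r k.+2 ord0 j - (q k.+2)%:R * r k.+1 ord0 j.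
  by rewrite [LHS]mxE [X in _ + X]mxE; congr (_ - _); rewrite [LHS]mxE.
have [q0 _ _ _] := hq.
have z0 i : 0 <= zeta i by exact: err_ge0.
have Q0 i : 0 <= (q i)%:R :> R by [].
have qm i j : (i <= j)%N -> (q i)%:R <= (q j)%:R :> R.
  by move=> ij; rewrite ler_nat (best_mono hq).
have zm i j : (i <= j)%N -> zeta j <= zeta i by exact: best_err_mono.
apply: (@le_trans _ _ `|(\det B)%:~R|).
  by rewrite -intr_norm -[(q nu)%:R]/((q nu)%:Z%:~R) ler_int.
rewrite detB; apply: le_trans (_ : 24 * (2 * (zeta k * zeta k.+1 * (q k.+2)%:R *
    (zeta nu * (q nu.+1)%:R))) <= _); last by rewrite mulrA -natrM.
have Zk1 : 0 <= zeta k * zeta k.+1 * (q k.+2)%:R by rewrite !mulr_ge0.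
(* The first entry of [w] is 0. Of the four products the one with [q nu.+1] dominates, since
   denominators grow and errors decrease. *)
apply: (@det4_bound _ _ _ _ _ (q nu)%:R 0 (q k)%:R (q nu.+1)%:R
   (zeta nu) (2 * (q k.+2)%:R * zeta k.+1) (zeta k) (zeta nu.+1)).
- by split=> [|j /rj //]; rewrite r0 ger0_norm.
- split=> [|j j0].
    by rewrite rwE !r0 mulrC subrr normr0.
  rewrite rwE; apply: le_trans (ler_normB _ _) _; rewrite !normrM !(ger0_norm (Q0 _)).
  have h1 := ler_pM (Q0 k.+1) (normr_ge0 _) (qm _ _ (leqnSn k.+1)) (rj k.+2 j j0).
  have h2 := ler_wpM2l (Q0 k.+2) (rj k.+1 j j0).
  have h3 := ler_wpM2l (Q0 k.+2) (zm _ _ (leqnSn k.+1)).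
  lra.
- by split=> [|j /rj //]; rewrite r0 ger0_norm.
- by split=> [|j /rj //]; rewrite r0 ger0_norm.
- have := ler_pM (Q0 nu) (z0 nu.+1) (qm _ _ (leqnSn nu)) (zm _ _ (leqnSn nu)).
  move=> /(ler_wpM2l Zk1); lra.
- rewrite mul0r; rewrite !mulr_ge0 //.
- have kn : (k <= nu.+1)%N by lia.
  have := ler_pM (Q0 k) (z0 nu.+1) (qm _ _ kn) (zm _ _ kn).
  have c0 : 0 <= zeta nu * zeta k.+1 * (q k.+2)%:R by rewrite !mulr_ge0.
  move=> /(ler_wpM2l c0); lra.
- lra.
Qed.

(** * Comparison of the exponents *)

(** By [best_prod_ge], [err Theta (q i)] is at least [1 / (2 * q i.+1)], which rules out any decay
    faster than [1 / q i.+1]. *)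
Lemma uniform_le1 (R : realType) n (Theta : 'M[R]_(n, 1)) (q : nat -> nat) (gamma : R) :
  best_seq Theta q -> (forall x : nat, (0 < x)%N -> 0 < err Theta x) -> 0 < gamma ->
  (limf_esup (fun t : R => (t `^ gamma)%:E * psi Theta t)
     (pinfty_nbhs R) < +oo)%E -> gamma <= 1.
Proof.
move=> hq err0 g0 /(uniform_best hq err0 g0)[C [N hN]].
rewrite leNgt; apply/negP => g1; have [q0 _ _ _] := hq.
have [N' hN'] := ln_best_pinfty hq ((C + ln 2) / (gamma - 1)).
set i := maxn N N'.
have := hN' i.+1 (leqW (leq_maxr _ _)); rewrite ltr_pdivrMr ?subr_gt0 //.
have := hN i (leq_maxl _ _); have := ln_ge0 (best_prod_ge hq i).
have e0 := best_err_gt0 hq err0 i.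
rewrite !lnM ?posrE ?mulr_gt0 ?ltr0n //; lra.
Qed.

Lemma uniform_exponent_fin (R : realType) n (Theta : 'M[R]_(n.+1, 1)) (q : nat -> nat) :
  best_seq Theta q -> (forall x : nat, (0 < x)%N -> 0 < err Theta x) ->
  exists alpha : R,
    [/\ uniform_exponent Theta = alpha%:E, n.+1%:R^-1 <= alpha & alpha <= 1].
Proof.
move=> hq err0; have := uniform_exponent_ge Theta.
have : (uniform_exponent Theta <= 1%:E)%E.
  apply: ub_ereal_sup => _ [gamma [g0 hg] <-].
  by rewrite lee_fin; exact: uniform_le1 hq err0 g0 hg.
by case: (uniform_exponent Theta) => // alpha; rewrite !lee_fin => h1 h2; exists alpha.
Qed.

(** Divided by [y ^+ 2] the hypothesis reads [1 - a <= a / y + a / y ^+ 2], with a right-hand side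
    strictly decreasing in [y]. *)
Lemma quadratic_scale (R : realFieldType) (a x y : R) :
  0 < a -> 0 <= x -> x < y -> (1 - a) * y ^+ 2 <= a * y + a ->
  (1 - a) * x ^+ 2 < a * x + a.
Proof.
move=> a0 x0 xy h; have y0 : 0 < y by exact: le_lt_trans xy.
have y20 : 0 < y ^+ 2 by rewrite exprn_gt0.
rewrite -subr_gt0 -(pmulr_rgt0 _ y20).
have -> : y ^+ 2 * (a * x + a - (1 - a) * x ^+ 2) =
  x ^+ 2 * (a * y + a - (1 - a) * y ^+ 2) + (a * (x * y * (y - x)) +
    a * ((y - x) * (y + x))) by ring.
apply: ltr_wpDl; first by rewrite mulr_ge0 ?sqr_ge0 ?subr_ge0.
apply: ltr_wpDl.
  by apply: mulr_ge0; [|apply: mulr_ge0; [apply: mulr_ge0|]]; lra.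
by apply: mulr_gt0 => //; apply: mulr_gt0; lra.
Qed.

(** [g] is the positive root of [D g^2 = a (1 - a) g + a], and [g >= 1] because
    [(3 a - 1) (1 - a) >= 0]. Substituting the equation, [D] times the gap in the second claim is
    [a^2 (a g - 1 + 2 a) >= a^2 (3 a - 1) >= 0]. *)
Lemma g1_spec (R : realType) (a : R) : 3^-1 <= a -> a <= 1 ->
  1 <= g1 a /\ (1 - a) * g1 a ^+ 2 <= a * g1 a + a.
Proof.
move=> a3 a1; have a0 : 0 < a by lra.
set g := g1 a; set D := 2 * a ^+ 2 - 2 * a + 1.
have DE : D = a ^+ 2 + (1 - a) ^+ 2 by rewrite /D; ring.
have D0 : 0 < D by rewrite DE; have := sqr_ge0 (1 - a); have := exprn_gt0 2 a0; lra.
have b0 : 0 <= a * (1 - a) by rewrite mulr_ge0; lra.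
have aD : 0 <= 4 * a * D by rewrite !mulr_ge0 //; lra.
set s := Num.sqrt (a ^+ 2 * (1 - a) ^+ 2 + 4 * a * D).
have gE : 2 * D * g = a * (1 - a) + s.
  by rewrite /g /g1 -/D -/s mulrC divfK // mulf_neq0 // lt0r_neq0.
have s0 : 0 < s by rewrite sqrtr_gt0 ltr_wpDl ?mulr_gt0 // -exprMn sqr_ge0.
have s2 : s ^+ 2 = a ^+ 2 * (1 - a) ^+ 2 + 4 * a * D.
  by rewrite sqr_sqrtr // addr_ge0 // -exprMn sqr_ge0.
have g0 : 0 < g by rewrite -(pmulr_rgt0 _ (_ : 0 < 2 * D)) ?gE; lra.
have quad : D * g ^+ 2 = a * (1 - a) * g + a.
  have D4 : 4 * D != 0 by rewrite mulf_neq0 ?lt0r_neq0.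
  apply: (mulfI D4).
  have e : (2 * D * g - a * (1 - a)) ^+ 2 = s ^+ 2 by congr (_ ^+ 2); lra.
  rewrite s2 in e; lra.
have ge1 : 1 <= g.
  rewrite leNgt; apply/negP => g1.
  have DE' : D <= a * (1 - a) + a.
    have : 0 <= (3 * a - 1) * (1 - a) by rewrite mulr_ge0; lra.
    rewrite /D; lra.
  have gg : g ^+ 2 < g by rewrite expr2 gtr_pMl.
  have g20 : 0 < g ^+ 2 by rewrite exprn_gt0.
  have h1 := ler_wpM2r (ltW g20) DE'.
  have h2 := ler_wpM2l b0 (ltW gg).
  have h3 : a * g ^+ 2 < a by rewrite gtr_pMr //; lra.
  lra.
split=> //; rewrite -subr_ge0 -(pmulr_rge0 _ D0).
have -> : D * (a * g + a - (1 - a) * g ^+ 2) =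
    a * (D * g + D) - (1 - a) * (D * g ^+ 2) by ring.
rewrite quad.
have -> : a * (D * g + D) - (1 - a) * (a * (1 - a) * g + a) = a ^+ 2 * (a * g - 1 + 2 * a).
  by rewrite /D; ring.
rewrite mulr_ge0 ?sqr_ge0 //.
have : 0 <= a * (g - 1) by rewrite mulr_ge0; lra.
lra.
Qed.

(* Applied with x i = ln q_i and l i = ln zeta_i: eliminating everything but   *)
(* x k.+1 bounds it from above, contradicting divergence.                     *)
Lemma exponent_contra (R : realType) (a gamma C C' : R) (N : nat) (x l : nat -> R) :
  0 < a -> a <= 1 -> 0 < gamma ->
  (1 - a) * (gamma / a) ^+ 2 < a * (gamma / a) + a ->
  (forall i j, (i <= j)%N -> x i <= x j) ->
  (forall B, exists N, forall i, (N <= i)%N -> B < x i) ->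
  (forall i, (N <= i)%N -> a * x i.+1 + l i <= C) ->
  (forall i, (N <= i)%N -> 0 <= gamma * x i + l i) ->
  (forall K, exists k nu, [/\ (K <= k)%N, (k.+1 < nu)%N &
    x nu <= C' + (l k + l k.+1 + x k.+2 + (l nu + x nu.+1))]) ->
  False.
Proof.
move=> a0 a1 g0 quad xm xinf ha hg hdet.
have quad' : (1 - a) * gamma ^+ 2 < a ^+ 2 * gamma + a ^+ 3.
  have a20 : 0 < a ^+ 2 by rewrite exprn_gt0.
  have := quad; rewrite -(ltr_pM2r a20).
  have -> : (1 - a) * (gamma / a) ^+ 2 * a ^+ 2 = (1 - a) * gamma ^+ 2.
    by rewrite -mulrA -exprMn divfK ?lt0r_neq0.
  have -> // : (a * (gamma / a) + a) * a ^+ 2 = a ^+ 2 * gamma + a ^+ 3.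
  by rewrite (mulrC a) divfK ?lt0r_neq0 //; ring.
pose e := (1 - a) * gamma - a ^+ 2.
pose D1 := a * (C' + 3 * C) + (1 - a) * C.
have d0 : 0 < a ^+ 3 - e * gamma by rewrite /e; lra.
(* This sign is what allows [v] to be replaced by the smaller [z] below. *)
have ga : 0 < a - (1 - a) * gamma.
  rewrite ltNge; apply/negP => h.
  have h1 : (1 - a) * gamma < a ^+ 2.
    have h2 := ler_wpM2r (ltW g0) h.
    rewrite -(ltr_pM2l a0); lra.
  have : a ^+ 2 <= a by rewrite expr2 ger_pMl.
  lra.
have [N1 hN1] := xinf (Num.max 0 (Num.max (D1 / a ^+ 2)
  ((a * D1 + e * C) / (a ^+ 3 - e * gamma)))).
have [k [nu [Kk knu hk]]] := hdet (maxn N N1).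
have := hN1 k.+1 ltac:(lia); rewrite !gt_max !ltr_pdivrMr ?exprn_gt0 //.
move=> /and3P[y0 y1 y2].
have Nk : (N <= k)%N by apply: leq_trans Kk; exact: leq_maxl.
have u1 := ha k Nk; have u2 := ha k.+1 (leqW Nk).
have Nnu : (N <= nu)%N by lia.
have u3 := ha nu Nnu; have u4 := hg nu Nnu; have u5 := hg k.+1 (leqW Nk).
have zv : x k.+2 <= x nu by exact: xm.
have yz : x k.+1 <= x k.+2 by exact: xm.
set y := x k.+1 in y0 y1 y2 u1 u5 yz *; set z := x k.+2 in u2 zv yz hk *.
set v := x nu in u4 zv hk *; set u := x nu.+1 in u3 hk *.
have b1 : v <= C' + 3 * C - a * y + (1 - a) * z + (1 - a) * u by lra.
have b2 : a * u <= C + gamma * v by lra.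
have b3 : a * z <= C + gamma * y by lra.
have a10 : 0 <= 1 - a by lra.
have b4 := ler_wpM2l a10 b2.
have b5 := ler_wpM2l (ltW a0) b1.
have b6 := ler_wpM2l (ltW ga) zv.
have b7 : a ^+ 2 * y <= D1 + e * z by rewrite /D1 /e; lra.
(* For [e <= 0] the term in [z] is dropped; for [e > 0] it is bounded through [b3], and [d0] makes
   the coefficient of [y] positive. *)
have [e0|e0] := leP e 0.
  have : e * z <= 0 by rewrite mulr_le0_ge0 //; lra.
  lra.
have b8 := ler_wpM2l (ltW a0) b7.
have b9 := ler_wpM2l (ltW e0) b3.
lra.
Qed.

Theorem theorem2 (R : realType) (theta1 theta2 theta3 : R)
  (hindep : forall c0 c1 c2 c3 : int,
     c0%:~R + c1%:~R * theta1 + c2%:~R * theta2 + c3%:~R * theta3 = 0 :> R ->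
     [/\ c0 = 0, c1 = 0, c2 = 0 & c3 = 0]) :
  let Theta : 'M[R]_(3, 1) := \col_(j < 3) [:: theta1; theta2; theta3]`_j in
  exists2 alpha : R, uniform_exponent Theta = alpha%:E &
    ((alpha * g1 alpha)%:E <= individual_exponent Theta)%E.
Proof.
move=> Theta.
have indep (c : 'cV[int]_(1 + 3)) :
    row_mx 1%:M Theta^T *m map_mx intr c = 0 -> c = 0.
  move=> /(congr1 (fun M : 'M[R]_1 => M ord0 ord0)).
  rewrite mxE [RHS]mxE big_split_ord big_ord1 !big_ord_recl big_ord0 /= addr0.
  rewrite !row_mxEl !row_mxEr !mxE /= mul1r => e.
  have [|c0 c1 c2 c3] := hindep (c (lshift 3 ord0) ord0) (c (rshift 1 ord0) ord0)
     (c (rshift 1 (lift ord0 ord0)) ord0) (c (rshift 1 (lift ord0 (lift ord0 ord0))) ord0).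
    by rewrite -[RHS]e; ring.
  apply/matrixP => i j; rewrite (ord1 j) mxE; case: (split_ordP i) => i1 ->.
    by rewrite (ord1 i1).
  case: i1 => [[|[|[|//]]] p].
  - by rewrite -[RHS]c1; congr (c (rshift _ _) _); apply: val_inj.
  - by rewrite -[RHS]c2; congr (c (rshift _ _) _); apply: val_inj.
  - by rewrite -[RHS]c3; congr (c (rshift _ _) _); apply: val_inj.
have err0 x : (0 < x)%N -> 0 < err Theta x.
  move=> x0; rewrite lt_def err_ge0 andbT; apply/eqP => e.
  have := dist_int_err Theta x ord0; rewrite e dist_intE normr_le0 subr_eq0 mxE /=.
  move=> /eqP ex; have [|_ /eqP] := hindep (- nint (x%:R * theta1)) x%:Z 0 0.
    by rewrite !mul0r !addr0 intrN -[(Posz _)%:~R]/(_%:R) -ex addrC subrr.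
  by rewrite eqz_nat => /eqP xz; rewrite xz in x0.
have [q hq] := best_approximations err0.
have [alpha [Ha a3 a1]] := uniform_exponent_fin hq err0.
exists alpha => //; have [gge gle] := g1_spec a3 a1; set g := g1 alpha in gge gle *.
have a0 : 0 < alpha by lra.
have ag0 : 0 < alpha * g by rewrite mulr_gt0 //; lra.
suff main gamma : 0 < gamma -> gamma < alpha * g ->
    (gamma%:E <= individual_exponent Theta)%E.
  case: (individual_exponent Theta) main => [r||] main; last 2 first.
  - by rewrite leey.
  - have h1 : 0 < alpha * g / 2 by lra.
    have h2 : alpha * g / 2 < alpha * g by lra.
    by have := main _ h1 h2; rewrite leNgt ltNyr.
  rewrite lee_fin leNgt; apply/negP => rlt.
  (* [r] may be negative while [main] asks for a positive [gamma], hence the maximum with 0. *)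
  have h : Num.max r 0 < alpha * g by rewrite gt_max rlt.
  have m0 : 0 <= Num.max r 0 by rewrite le_max lexx orbT.
  have mr : r <= Num.max r 0 by rewrite le_max lexx.
  have h1 : 0 < (Num.max r 0 + alpha * g) / 2 by lra.
  have h2 : (Num.max r 0 + alpha * g) / 2 < alpha * g by lra.
  have := main _ h1 h2; rewrite lee_fin; lra.
move=> gam0 gamlt; apply: ereal_sup_ubound; exists gamma => //; split=> //.
apply: contrapT => /(individual_best hq err0)[N2 hN2].
have ga_lt : gamma / alpha < g by rewrite ltr_pdivrMr // mulrC.
have ga0 : 0 < gamma / alpha by rewrite divr_gt0.
pose g' := (gamma / alpha + g) / 2.
have gg' : gamma / alpha < g' by rewrite /g'; lra.
have g'g : g' < g by rewrite /g'; lra.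
have g'0 : 0 < g' by lra.
have := quadratic_scale a0 (ltW g'0) g'g gle => hg'.
have p0 : 0 < g' ^+ 2 + g' + 1 by have := exprn_gt0 2 g'0; lra.
(* The supremum [alpha] may not be attained, so some admissible [a] near it is used. The first bound
   gives [gamma / a < g'], the second is [(1 - a) g'^2 < a g' + a] solved for [a]. *)
have : ((Num.max (gamma / g') (g' ^+ 2 / (g' ^+ 2 + g' + 1)))%:E <
    uniform_exponent Theta)%E.
  rewrite Ha lte_fin gt_max !ltr_pdivrMr //; apply/andP; split; last by lra.
  by rewrite mulrC -ltr_pdivrMr.
move=> /ereal_sup_gt[_ [a [pa ua] <-]]; rewrite lte_fin gt_max !ltr_pdivrMr //.
move=> /andP[ga gq].
have ale1 : a <= 1 by exact: uniform_le1 hq err0 pa ua.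
have [C [N1 hN1]] := uniform_best hq err0 pa ua.
pose x i := ln ((q i)%:R : R); pose l i := ln (err Theta (q i)).
have [q0 _ _ _] := hq; have e0 := best_err_gt0 hq err0.
have qR0 i : (0 : R) < (q i)%:R by rewrite ltr0n.
apply: (@exponent_contra _ a gamma C (ln 48) (maxn N1 N2) x l) => //.
- apply: (@quadratic_scale _ _ _ g') => //; last by lra.
    by rewrite divr_ge0 ?ltW.
  by rewrite ltr_pdivrMr // mulrC.
- by move=> i j ij; rewrite /x ler_ln ?posrE // ler_nat (best_mono hq).
- exact: ln_best_pinfty hq.
- by move=> i iN; apply: hN1; apply: leq_trans iN; exact: leq_maxl.
- by move=> i iN; apply: hN2; apply: leq_trans iN; exact: leq_maxr.
move=> K; have [k [nu [Kk knu h]]] := best_det hq indep K; exists k, nu; split=> //.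
rewrite -ler_ln ?posrE ?mulr_gt0 // in h.
by rewrite !lnM ?posrE ?mulr_gt0 in h.
Qed.
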